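(* Let $\kappa$ be an uncountable strong limit cardinal, let $I$ be a set and let $(C_i)_{i\in I}$ be a family of $\kappa$-compactological sets $C_i=(X_i,\mathscr C_i)$. (1) The coproduct of $(C_i)_{i\in I}$ exists in both $\mathbf{Cmp}$ and $\mathbf{Cmp}_\kappa$ and is given by $$\Bigl(X:=\coprod_{i\in I}X_i,\ \ \mathscr C:=\overline{\bigsqcup_{i\in I}\mathscr C_i}^{\,\cup_{\mathrm{fin}}}\Bigr),$$ where $\overline{(-)}^{\,\cup_{\mathrm{fin}}}$ denotes the closure under finite unions. The associated topology of the coproduct is the usual coproduct topology. (2) The product of $(C_i)_{i\in I}$ in $\mathbf{Cmp}$ exists and is given by $$\Bigl(X:=\prod_{i\in I}X_i,\ \ \mathscr C:=\overline{\Bigl\{\prod_{i\in I}K_i\ \Bigm|\ \forall\, i\in I\colon K_i\in\mathscr C_i\Bigr\}}^{\,\cap\,\cup_{\mathrm{fin}}}\Bigr),$$ where for $\mathscr B\subseteq\mathcal P(X)$ we denote by $\overline{\mathscr B}^{\,\cap\,\cup_{\mathrm{fin}}}$ the collection of sets that can be written as an intersection over a non-empty collection of finite unions of elements of $\mathscr B$. If $I$ is finite, the topology on $X$ induced by $\mathscr C$ is the topology of the product of the associated spaces computed in $\mathbf{CGWH}$. (3) The product of $(C_i)_{i\in I}$ exists in $\mathbf{Cmp}_\kappa$ as well, and it is obtained by computing the product in $\mathbf{Cmp}$ and retaining only the $\kappa$-small elements (those of cardinality $<\kappa$) of the compactology. In particular, it agrees with the product in $\mathbf{Cmp}$ whenever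 the involved spaces and the index set are sufficiently small in comparison to $\kappa$; among others this includes the case when both $|I|$ and $\sup_{K\in\bigcup_{i\in I}\mathscr C_i}|K|$ are strictly smaller than $\kappa$, and the case when $|I|<\operatorname{cof}(\kappa)$.
   Context: ''Compact'' always means quasi-compact and Hausdorff. A compactological set is a triple $(X,\mathscr C,(\tau_K)_{K\in\mathscr C})$ where $X$ is a set, $\mathscr C\subseteq\mathcal P(X)$ is a non-empty collection (the compactology), and each $\tau_K$ is a topology on $K$ such that $(K,\tau_K)$ is compact and: (a) $\bigcup\mathscr C=X$; (b) for $K_1,K_2\in\mathscr C$ there is $K_3\in\mathscr C$ with $K_1\cup K_2\subseteq K_3$; (c) $\tau_{K_2}=\tau_{K_1}|_{K_2}$ for $K_2\subseteq K_1$ in $\mathscr C$; (d) compact subsets of $(K_1,\tau_{K_1})$, $K_1\in\mathscr C$, belong to $\mathscr C$. The $\tau_K$ are determined by $\mathscr C$ (the open sets of $K$ are exactly the $K\setminus K'$ with $K'\in\mathscr C$), so one writes $(X,\mathscr C)$. The topology associated to (induced by) $\mathscr C$ on $X$ is the final topology with respect to the inclusions $(K,\tau_K)\hookrightarrow X$, $K\in\mathscr C$; the resulting space is compactly generated weak Hausdorff. Morphisms are maps $f\colon X\to X'$ with $f(K)\in\mathscr C'$ and $f|_K\colon (K,\tau_K)\to (f(K),\tau_{f(K)})$ continuous for all $K\in\mathscr C$. This is the category $\mathbf{Cmp}$. A compactological set is $\kappa$-compactological if $|K|<\kappa$ for all $K\in\mathscr C$; these form the full subcategory $\mathbf{Cmp}_\kappa$.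 A space $X$ is weak Hausdorff if $f(S)$ is closed for every compact $S$ and continuous $f\colon S\to X$, and compactly generated if $F\subseteq X$ is closed iff $f^{-1}(F)$ is closed for all such $f$. $\mathbf{CGWH}$ is the category of compactly generated weak Hausdorff spaces with continuous maps. *)

(* Defs.v *)
From HB Require Import structures.
From mathcomp Require Import all_boot all_order.
From mathcomp Require Import all_classical.
From mathcomp Require wochoice.
From mathcomp Require Import topology.

Set Implicit Arguments.
Unset Strict Implicit.
Unset Printing Implicit Defensive.

Local Open Scope classical_set_scope.
Local Open Scope card_scope.

Definition card_lt (T U : Type) (A : set T) (B : set U) : Prop :=
  A #<= B /\ ~ (B #<= A).

(* A cardinal is an initial ordinal: a well-ordered type none of whose proper
   initial segments has the same cardinality as the whole type. *)
Record cardinal := Cardinal {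
  card_sort :> Type;
  card_order : rel card_sort;
  card_well_order : wochoice.well_order card_order;
  card_initial : forall x,
    card_lt [set y | ~~ card_order x y] [set: card_sort]
}.

Definition uncountable (kappa : cardinal) : Prop := ~ countable [set: kappa].

Definition strong_limit (kappa : cardinal) : Prop :=
  forall (T : Type) (A : set T), card_lt A [set: kappa] ->
    card_lt [set B : set T | B `<=` A] [set: kappa].

Definition cofinal (kappa : cardinal) (S : set kappa) : Prop :=
  forall x, exists2 y, S y & card_order x y.

(* [cof kappa] is the cardinality of a cofinal subset of least cardinality. *)
Definition card_lt_cof (T : Type) (A : set T) (kappa : cardinal) : Prop :=
  exists S : set kappa,
    [/\ cofinal S, (forall S' : set kappa, cofinal S' -> S #<= S') &
        card_lt A S].

Definition is_card_sup (J : Type) (T : J -> Type) (A : forall j, set (T j))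
    (U : Type) (L : set U) : Prop :=
  (forall j, A j #<= L) /\
  (forall (V : Type) (M : set V), (forall j, A j #<= M) -> L #<= M).

Record topology_on (T : Type) := TopologyOn {
  is_open : set (set T);
  is_open_setT : is_open setT;
  is_open_setI : setI_closed is_open;
  is_open_bigcup : forall (I : Type) (f : I -> set T),
    (forall i, is_open (f i)) -> is_open (\bigcup_i f i)
}.

(* [T] itself, carrying [t] as its canonical topology. *)
Definition space (T : Type) (t : topology_on T) : Type := T.

HB.instance Definition _ T (t : topology_on T) := gen_eqMixin (space t).
HB.instance Definition _ T (t : topology_on T) := gen_choiceMixin (space t).
HB.instance Definition _ T (t : topology_on T) :=
  isOpenTopological.Build (space t)
    (is_open_setT t) (@is_open_setI T t) (@is_open_bigcup T t).

Definition compact_hausdorff (T : topologicalType) : Prop :=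
  compact [set: T] /\ hausdorff_space T.

Lemma sig_ext (T : Type) (P : T -> Prop) (u v : {x : T | P x}) :
  sval u = sval v -> u = v.
Proof. by case: u v => [u Pu] [v Pv]; exact: eq_exist. Qed.

Record category := Category {
  obj :> Type;
  hom : obj -> obj -> Type;
  idm : forall a, hom a a;
  comp : forall a b c, hom b c -> hom a b -> hom a c;
  comp1m : forall a b (f : hom a b), comp (idm b) f = f;
  compm1 : forall a b (f : hom a b), comp f (idm a) = f;
  compA : forall a b c d (h : hom c d) (g : hom b c) (f : hom a b),
    comp h (comp g f) = comp (comp h g) f
}.

Arguments hom : clear implicits.

Definition full_subcategory (D : category) (P : D -> Prop) : category :=
  @Category {a : D | P a} (fun a b => hom D (sval a) (sval b))
    (fun a => idm (sval a))
    (fun a b c => @comp D (sval a) (sval b) (sval c))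
    (fun a b => @comp1m D (sval a) (sval b))
    (fun a b => @compm1 D (sval a) (sval b))
    (fun a b c d => @compA D (sval a) (sval b) (sval c) (sval d)).

Definition is_product (D : category) (I : Type) (F : I -> D) (P : D)
    (p : forall i, hom D P (F i)) : Prop :=
  forall (Z : D) (f : forall i, hom D Z (F i)),
    exists! g : hom D Z P, forall i, comp (p i) g = f i.

Definition is_coproduct (D : category) (I : Type) (F : I -> D) (S : D)
    (s : forall i, hom D (F i) S) : Prop :=
  forall (Z : D) (f : forall i, hom D (F i) Z),
    exists! g : hom D S Z, forall i, comp g (s i) = f i.

Arguments is_product D {I} F P p.
Arguments is_coproduct D {I} F S s.

Definition top_hom (X Y : topologicalType) := {f : X -> Y | continuous f}.

Definition top_id (X : topologicalType) : top_hom X X :=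
  exist (fun f : X -> X => continuous f) id (fun x => @cvg_id _ (nbhs x)).

Lemma top_comp_subproof (X Y Z : topologicalType) (g : top_hom Y Z)
  (f : top_hom X Y) : continuous (sval g \o sval f).
Proof.
by case: f g => [f cf] [g cg] x; apply: continuous_comp; [exact: cf|exact: cg].
Qed.

Definition top_comp (X Y Z : topologicalType) (g : top_hom Y Z) (f : top_hom X Y) :
  top_hom X Z :=
  exist (fun h : X -> Z => continuous h) (sval g \o sval f) (@top_comp_subproof X Y Z g f).

Program Definition Top : category := @Category _ top_hom top_id top_comp _ _ _.
Next Obligation. by move=> *; exact: sig_ext. Qed.
Next Obligation. by move=> *; exact: sig_ext. Qed.
Next Obligation. by move=> *; exact: sig_ext. Qed.

Definition weak_hausdorff (T : topologicalType) : Prop :=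
  forall (S : topologicalType) (f : S -> T),
    compact_hausdorff S -> continuous f -> closed (range f).

Definition compactly_generated (T : topologicalType) : Prop :=
  forall F : set T, closed F <->
    (forall (S : topologicalType) (f : S -> T),
       compact_hausdorff S -> continuous f -> closed (f @^-1` F)).

Definition is_cgwh (T : topologicalType) : Prop :=
  compactly_generated T /\ weak_hausdorff T.

Definition CGWH : category := @full_subcategory Top is_cgwh.

(* [ktop K] is only meaningful when [K] is a member of the compactology. *)
Record compactology (X : Type) := Compactology {
  members : set (set X);
  ktop : forall K : set X, topology_on K;
  members_nonempty : members !=set0;
  members_compact : forall K, members K -> compact_hausdorff (space (ktop K));
  members_cover : \bigcup_(K in members) K = setT;
  members_directed : forall K1 K2, members K1 -> members K2 ->
    exists2 K3, members K3 & K1 `|` K2 `<=` K3;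
  ktop_restrict : forall K1 K2 (K21 : K2 `<=` K1),
    members K1 -> members K2 ->
    is_open (ktop K2) = [set subfun K21 @^-1` V | V in is_open (ktop K1)];
  members_subcompact : forall K (A : set (space (ktop K))),
    members K -> compact A -> members (@set_val X K @` A)
}.

Record cmpSet := CmpSet {
  carrier :> Type;
  cmpl : compactology carrier
}.

Definition same_compactology (X : Type) (c c' : compactology X) : Prop :=
  members c = members c' /\
  (forall K, members c K -> is_open (ktop c K) = is_open (ktop c' K)).

Section AssociatedTopology.
Variables (X : Type) (c : compactology X).

Definition final_open : set (set X) := [set U | forall K, members c K ->
  is_open (ktop c K) (@set_val X K @^-1` U)].

Lemma final_open_setT : final_open setT.
Proof. by move=> K _; rewrite preimage_setT; exact: is_open_setT. Qed.

Lemma final_open_setI : setI_closed final_open.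
Proof.
move=> U V oU oV K cK; rewrite preimage_setI.
by apply: is_open_setI; [exact: oU|exact: oV].
Qed.

Lemma final_open_bigcup (I : Type) (f : I -> set X) :
  (forall i, final_open (f i)) -> final_open (\bigcup_i f i).
Proof.
move=> of_ K cK; rewrite preimage_bigcup.
by apply: is_open_bigcup => i; exact: of_.
Qed.

Definition associated_topology : topology_on X :=
  TopologyOn final_open_setT final_open_setI final_open_bigcup.
End AssociatedTopology.

Definition associated_space (X : cmpSet) : topologicalType :=
  space (associated_topology (cmpl X)).

Definition corestr (X Y : Type) (f : X -> Y) (K : set X) (x : K) : f @` K :=
  SigSub (mem_set (imageP f (set_valP x))).

Definition is_cmp_morphism (X Y : cmpSet) (f : X -> Y) : Prop :=
  forall K, members (cmpl X) K ->
    members (cmpl Y) (f @` K) /\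
    continuous (@corestr X Y f K :
      space (ktop (cmpl X) K) -> space (ktop (cmpl Y) (f @` K))).

Definition cmp_hom (X Y : cmpSet) := {f : X -> Y | is_cmp_morphism f}.

Lemma cmp_id_subproof (X : cmpSet) : is_cmp_morphism (@id X).
Proof.
move=> K cK; split; first by rewrite image_id.
suff H : forall L, K = L -> forall r : K -> L, (forall x, val (r x) = val x) ->
    continuous (r : space (ktop (cmpl X) K) -> space (ktop (cmpl X) L)).
  by apply: (H (id @` K)) => //; rewrite image_id.
move=> L <- r rE; have -> : r = id by apply/funext => x; exact/val_inj.
by move=> x; exact: cvg_id.
Qed.

Lemma cmp_comp_subproof (X Y Z : cmpSet) (g : cmp_hom Y Z) (f : cmp_hom X Y) :
  is_cmp_morphism (sval g \o sval f).
Proof.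
case: f g => [f hf] [g hg] K cK /=.
have [cfK cf] := hf _ cK; have [cgfK cg] := hg _ cfK.
split; first by rewrite -image_comp.
suff H : forall L, g @` (f @` K) = L ->
    forall r : K -> L, (forall x, val (r x) = g (f (val x))) ->
    continuous (r : space (ktop (cmpl X) K) -> space (ktop (cmpl Z) L)).
  by apply: (H ((g \o f) @` K)) => //; rewrite image_comp.
move=> L <- r rE.
have -> : r = @corestr _ _ g (f @` K) \o @corestr _ _ f K.
  by apply/funext => x; apply/val_inj; rewrite rE.
move=> x; apply: (@continuous_comp (space (ktop (cmpl X) K))
  (space (ktop (cmpl Y) (f @` K))) (space (ktop (cmpl Z) (g @` (f @` K))))).
  exact: cf.
exact: cg.
Qed.

Definition cmp_comp (X Y Z : cmpSet) (g : cmp_hom Y Z) (f : cmp_hom X Y) :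
  cmp_hom X Z := exist _ (sval g \o sval f) (@cmp_comp_subproof X Y Z g f).

Program Definition Cmp : category :=
  @Category cmpSet cmp_hom (fun X => exist _ id (@cmp_id_subproof X)) cmp_comp
    _ _ _.
Next Obligation. by move=> *; exact: sig_ext. Qed.
Next Obligation. by move=> *; exact: sig_ext. Qed.
Next Obligation. by move=> *; exact: sig_ext. Qed.

Definition kappa_compactological (kappa : cardinal) (X : cmpSet) : Prop :=
  forall K, members (cmpl X) K -> card_lt K [set: kappa].

Definition Cmp_kappa (kappa : cardinal) : category :=
  @full_subcategory Cmp (kappa_compactological kappa).

(* The empty union is allowed: the empty set always belongs to [fin_unions B]. *)

Definition fin_unions (X : Type) (B : set (set X)) : set (set X) :=
  [set \bigcup_(K in F) K | F in [set F | finite_set F /\ F `<=` B]].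

Definition inter_fin_unions (X : Type) (B : set (set X)) : set (set X) :=
  [set \bigcap_(K in G) K | G in [set G | G !=set0 /\ G `<=` fin_unions B]].

Definition disjoint_members (I : Type) (C : I -> cmpSet) :
    set (set {i : I & C i}) :=
  \bigcup_(i : I) [set existT (fun j => C j : Type) i @` K
                  | K in members (cmpl (C i))].

Arguments disjoint_members {I} C _.

Definition box (I : Type) (X : I -> Type) (K : forall i, set (X i)) :
  set (forall i, X i) := [set x | forall i, K i (x i)].

Definition box_members (I : Type) (C : I -> cmpSet) : set (set (forall i, C i)) :=
  [set @box I (fun i => C i) K
  | K in [set K | forall i, members (cmpl (C i)) (K i)]].

Arguments box_members {I} C _.

(* Main.v *)
(* The closed subsets of a member [K] of a compactology are exactly the members
   contained in [K], so a compactology is determined by its collection of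
   members, and compactness, separation and continuity can all be expressed with
   members only: compactness says that an ultrafilter containing a member has a
   limit lying in every member that belongs to it. In this form the coproduct is
   checked slice by slice, and Tychonoff's theorem is a pointwise choice of
   limits: an ultrafilter containing a finite union of boxes contains one of
   them.

   For the topology of a finite product, a closed set of the product meets each
   product of members in a closed set; one factor at a time, the members are
   replaced by a continuous map from a compact space, by a tube argument.

   Cardinals below [kappa] are those that inject into a proper initial segment
   of [kappa]; sums, products and sets of functions are coded inside iterated
   power sets, which stay below a strong limit. *)
Require Import Defs.
From mathcomp Require Import all_boot all_order.
From mathcomp Require Import all_classical.
From mathcomp Require wochoice.
From mathcomp Require Import topology.

Set Implicit Arguments.
Unset Strict Implicit.
Unset Printing Implicit Defensive.

Local Open Scope classical_set_scope.
Local Open Scope card_scope.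

(** * Cardinals below a strong limit *)

Lemma card_le_inj (T U : Type) (A : set T) (B : set U) (f : T -> U) :
  (forall x, A x -> B (f x)) -> {in A &, injective f} -> A #<= B.
Proof.
move=> AB finj; rewrite -(card_le_eql (inj_card_eq finj)).
by apply: subset_card_le => _ [x Ax <-]; exact: AB.
Qed.

Section Smallness.
Variable kappa : cardinal.

Local Notation small A := (card_lt A [set: kappa]).
Local Notation lt y x := (~~ card_order x y).

Lemma order_min (P : set kappa) : P !=set0 ->
  exists2 z, P z & forall y, P y -> card_order z y.
Proof.
move=> [x Px]; have [|z [[zP zle] _]] := @card_well_order kappa (mem P).
  by exists x; exact/mem_set.
by exists z => [|y Py]; [exact/set_mem|apply: zle; exact/mem_set].
Qed.

Lemma order_total (x y : kappa) : card_order x y \/ card_order y x.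
Proof.
have [|z [->|->] zle] := @order_min [set x; y]; first by exists x; left.
- by left; apply: zle; right.
- by right; apply: zle; left.
Qed.

Lemma order_refl (x : kappa) : card_order x x.
Proof. by case: (order_total x x). Qed.

(** Both [x] and [y] are then minima of the pair, and a minimum is unique. *)
Lemma order_anti (x y : kappa) : card_order x y -> card_order y x -> x = y.
Proof.
move=> xy yx; have [|z [_ uniq]] := @card_well_order kappa (mem [set x; y]).
  by exists x; apply/mem_set; left.
have minP w : [set x; y] w -> wochoice.minimum_of (@card_order kappa) (mem [set x; y]) w.
  by case=> ->; split; (try by move=> ? /set_mem[] ->; rewrite ?order_refl);
    apply/mem_set; [left|right].
by rewrite -(uniq x (minP _ (or_introl erefl))) (uniq y (minP _ (or_intror erefl))).
Qed.

Lemma order_lt_wf : well_founded (fun y x : kappa => lt y x).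
Proof.
move=> x; apply: contrapT => nx.
have [|z zA zle] := @order_min [set z | ~ Acc (fun y x : kappa => lt y x) z].
  by exists x.
apply: zA; constructor => y yz; apply: contrapT => ny.
by move/negP: yz; apply; exact: zle.
Qed.

(** The least of the three elements decides: were [z] below [x], each of the three choices would
    force [y] below [x]. *)
Lemma order_lt_trans (x y z : kappa) : lt x y -> card_order y z -> lt x z.
Proof.
move=> yx yz; apply/negP => zx.
have xy : card_order x y by case: (order_total x y) => // h; rewrite h in yx.
have [|w wP wle] := @order_min [set x; y; z]; first by exists x; left; left.
have wx := wle x (or_introl (or_introl erefl)).
have wy := wle y (or_introl (or_intror erefl)).
have wz := wle z (or_intror erefl).
move: wx wy wz; case: wP => [[->|->]|->] wx wy wz.
- by rewrite (order_anti wz zx) yz in yx.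
- by rewrite wx in yx.
- by rewrite (order_anti yz wy) zx in yx.
Qed.

Lemma small_le (T U : Type) (A : set T) (B : set U) :
  A #<= B -> small B -> small A.
Proof.
move=> AB [Bk kB]; split; first exact: card_le_trans AB Bk.
by move=> kA; apply: kB; exact: card_le_trans kA AB.
Qed.

(* Transfinite recursion picks a new element of [A] at each stage for as long
   as there is one, and so decides which of [A] and [kappa] is larger. *)
Lemma card_le_segment (T : Type) (A : set T) :
  [set: kappa] #<= A \/ exists x : kappa, A #<= [set y | lt y x].
Proof.
have [->|/set0P[a0 Aa0]] := eqVneq A set0.
  have [[x _]|k0] := pselect ([set: kappa] !=set0).
    by right; exists x; exact: card_ge0.
  by left; apply/card_le0P; rewrite -subset0 => x _; case: k0; exists x.
pose step (x : kappa) (rec : forall y : kappa, lt y x -> T) : T :=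
  @xget {classic T} a0 [set a | A a /\ forall y (yx : lt y x), a <> rec y yx].
pose f := Fix order_lt_wf (fun=> T) step.
have fE x : f x = @xget {classic T} a0 [set a | A a /\ forall y, lt y x -> a <> f y].
  rewrite /f Fix_eq // => {}x g h gh.
  by congr step; apply: functional_extensionality_dep => y; apply/funext => yx.
have [[x Hx]|H] := pselect (exists x, forall a, A a -> exists2 y, lt y x & a = f y).
  right; exists x; apply: card_le_trans (card_image_le f _).
  by apply: subset_card_le => a /Hx[y yx ->]; exists y.
left; have fA x : A (f x) /\ forall y, lt y x -> f x <> f y.
  rewrite fE; case: xgetP => [a -> //|nx]; exfalso; apply: H.
  exists x => a Aa; apply: contrapT => na; apply: (nx a); split=> // y yx ay.
  by apply: na; exists y.
apply: (@card_le_inj _ _ _ _ f) => [x _|x y _ _ fxy]; first by have [] := fA x.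
apply: contrapT => xy.
have /orP[xy'|xy'] : lt x y || lt y x.
- by rewrite -negb_and; apply/negP => /andP[h1 h2]; apply: xy; exact: order_anti.
- by have [_ /(_ _ xy')] := fA y; rewrite fxy.
- by have [_ /(_ _ xy')] := fA x; rewrite fxy.
Qed.

Lemma small_segment (x : kappa) : small [set y | lt y x].
Proof. exact: card_initial. Qed.

Lemma smallP (T : Type) (A : set T) :
  small A <-> exists x : kappa, A #<= [set y | lt y x].
Proof.
split=> [[_ Ak]|[x Ax]]; last exact: small_le Ax (small_segment x).
by case: (card_le_segment A) => // /Ak.
Qed.

Hypotheses (kappa_unc : uncountable kappa) (kappa_lim : strong_limit kappa).

Lemma small_finite (T : Type) (A : set T) : finite_set A -> small A.
Proof.
move=> fA; case: (card_le_segment A) => [kA|[x Ax]]; last by apply/smallP; exists x.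
by case: kappa_unc; apply: finite_set_countable; exact: card_le_finite kA fA.
Qed.

Lemma segment_code (T : Type) (A : set T) (x : kappa) :
  A #<= [set y | lt y x] ->
  exists f : T -> kappa, (forall a, A a -> lt (f a) x) /\ {in A &, injective f}.
Proof.
case/card_leP=> f.
pose g a := match pselect (A a) with
  | left Aa => sval (f (SigSub (mem_set Aa))) | right _ => x end.
exists g; split=> [a Aa|a b /set_mem Aa /set_mem Ab]; rewrite /g.
  by case: pselect => // {}Aa; exact: (set_valP (f (SigSub (mem_set Aa)))).
case: pselect => // {}Aa; case: pselect => // {}Ab /val_inj fab.
by have /(congr1 val) := @inj _ _ _ f _ _ (mem_set I) (mem_set I) fab.
Qed.

Lemma small_code (T : Type) (A : set T) : small A ->
  exists (x : kappa) (f : T -> kappa),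
    (forall a, A a -> lt (f a) x) /\ {in A &, injective f}.
Proof. by case/smallP => x /segment_code fP; exists x. Qed.

Lemma order_max (x y : kappa) : exists z,
  (forall w, lt w x -> lt w z) /\ (forall w, lt w y -> lt w z).
Proof.
by case: (order_total x y) => xy; [exists y|exists x]; split=> // w wx;
  exact: order_lt_trans xy.
Qed.

(** The left summand is coded by $\{\{f a\}\}$ and the right one by $\{\emptyset,\{g b\}\}$, in the
    double power set of one segment; the element $\emptyset$ tells them apart. *)
Lemma small_sum (T U : Type) (A : set T) (B : set U) : small A -> small B ->
  small [set s : T + U | match s with inl a => A a | inr b => B b end].
Proof.
move=> /small_code[x [f [fx finj]]] /small_code[y [g [gy ginj]]].
have [z [xz yz]] := order_max x y.
apply: (@small_le _ _ _ _ _ (kappa_lim (kappa_lim (small_segment z)))).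
pose code (s : T + U) : set (set kappa) := match s with
  inl a => [set [set f a]] | inr b => [set set0; [set g b]] end.
have n0 (a : kappa) : set0 <> [set a].
  by move=> h; have : [set a] a by []; rewrite -h.
apply: (@card_le_inj _ _ _ _ code).
  move=> [a /= Aa|b /= Bb] D /=; first by move=> -> w ->; exact/xz/fx.
  by move=> [->//|-> w ->]; exact/yz/gy.
move=> [a|b] [a'|b'] /set_mem/= h /set_mem/= h' e.
- congr inl; apply: finj; rewrite ?inE //.
  have : [set [set f a']] [set f a] by rewrite -e.
  by move=> /= E; have : [set f a] (f a) by []; rewrite E.
- have : [set [set f a]] set0 by rewrite e; left.
  by move=> /n0.
- have : [set [set f a']] set0 by rewrite -e; left.
  by move=> /n0.
- congr inr; apply: ginj; rewrite ?inE //.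
  have : [set set0; [set g b']] [set g b] by rewrite -e; right.
  move=> [/esym/n0//|E]; have : [set g b] (g b) by []; rewrite E //.
Qed.

Lemma small_setU (T : Type) (A B : set T) : small A -> small B -> small (A `|` B).
Proof.
move=> sA sB; apply: small_le (small_sum sA sB).
pose f (s : T + T) := match s with inl a => a | inr b => b end.
apply: card_le_trans (card_image_le f _); apply: subset_card_le => x [Ax|Bx].
  by exists (inl x).
by exists (inr x).
Qed.

(** A pair is coded by the two-element subset of the sum formed by its components, so one power set
    is enough. *)
Lemma small_setX (T U : Type) (A : set T) (B : set U) :
  small A -> small B -> small (A `*` B).
Proof.
move=> sA sB; apply: small_le (kappa_lim (small_sum sA sB)).
pose f (p : T * U) : set (T + U) := [set inl p.1; inr p.2].
apply: (@card_le_inj _ _ _ _ f) => [[a b] [/= Aa Bb] s [->|->]//|].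
move=> [a b] [a' b'] _ _ e; congr pair.
  by have [[]|] : f (a', b') (inl a) by rewrite -e; left.
by have [|[]] : f (a', b') (inr b) by rewrite -e; right.
Qed.

(** A tuple is coded by its graph. The bound [x] common to all factors places every graph in the
    square of one segment, whose power set is small. *)
Lemma small_box (J : Type) (X : J -> Type) (K : forall j, set (X j)) (x : kappa) :
  small [set: J] -> (forall j, K j #<= [set y | lt y x]) -> small (box K).
Proof.
move=> /small_code[y [h [hy hinj]]] Kx.
have [z [xz yz]] := order_max x y.
pose f j := sval (cid (segment_code (Kx j))).
have fP j := svalP (cid (segment_code (Kx j))); rewrite -/(f _) in fP.
apply: small_le (kappa_lim (small_setX (small_segment z) (small_segment z))).
pose graph (u : forall j, X j) : set (kappa * kappa) := range (fun j => (h j, f j (u j))).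
apply: (@card_le_inj _ _ _ _ graph) => [u Ku _ [j _ <-]|].
  by split; [exact/yz/hy|have [fK _] := fP j; exact/xz/fK].
move=> u v /set_mem Ku /set_mem Kv uv.
apply: functional_extensionality_dep => j.
have : graph v (h j, f j (u j)) by rewrite -uv; exists j.
case=> i _ [/hinj ij]; rewrite ij ?inE // => fuv.
by have [_ finj] := fP j; apply: finj; rewrite ?inE.
Qed.

End Smallness.

(** * Ultrafilters and compact families *)

Section Ultrafilters.

Lemma ultraP (T : Type) (F : set_system T) : ProperFilter F ->
  (forall A, F A \/ F (~` A)) -> UltraFilter F.
Proof.
move=> PF dich; split=> // G PG FG; rewrite predeqE => A; split=> [GA|]; last exact: FG.
have [//|/FG GcA] := dich A.
have : G set0 by rewrite -(setICr A); exact: filterI.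
by move=> /(@filter_not_empty _ G).
Qed.

Lemma ultra_setU (T : Type) (F : set_system T) (A B : set T) : UltraFilter F ->
  F (A `|` B) -> F A \/ F B.
Proof.
move=> uF FAB; have [//|FcA] := in_ultra_setVsetC A uF; first by left.
right; have PF := @ultra_proper _ _ uF.
by apply: filterS (filterI FAB FcA) => x [[]].
Qed.

Lemma ultra_push (T U : Type) (f : T -> U) (F : set_system T) : UltraFilter F ->
  UltraFilter (fmap f F).
Proof.
move=> uF; have PF := @ultra_proper _ _ uF.
apply: ultraP => A; rewrite !fmapE preimage_setC; exact: in_ultra_setVsetC.
Qed.

Lemma ultra_pull (T U : Type) (f : T -> U) (F : set_system U) :
  injective f -> UltraFilter F -> F (range f) ->
  UltraFilter [set A : set T | F (f @` A)].
Proof.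
move=> finj uF Ff; have PF := @ultra_proper _ _ uF.
apply: ultraP.
  split=> /=; first by rewrite image_set0; exact: filter_not_empty.
  split=> /= [|P Q FP FQ|P Q PQ]; first exact: Ff.
    have FPQ : F ((f @` P) `&` (f @` Q)) by exact: filterI.
    apply: filterS FPQ => _ [[x Px <-] [y Qy /finj yx]].
    by exists x => //; split=> //; rewrite -yx.
  by apply: filterS; exact: image_subset.
move=> A /=; have [FA|FcA] := in_ultra_setVsetC (f @` A) uF; first by left.
right; apply: filterS (filterI Ff FcA) => _ [[x _ <-] nfx].
by exists x => // Ax; apply: nfx; exists x.
Qed.

End Ultrafilters.

(** * Closure under finite unions *)

Section FinUnions.
Variables (X : Type) (B : set (set X)).

Lemma fin_unions0 : fin_unions B set0.
Proof. by exists set0; [split=> //; exact: finite_set0|rewrite bigcup_set0]. Qed.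

Lemma sub_fin_unions : B `<=` fin_unions B.
Proof.
move=> K BK; exists [set K]; last by rewrite bigcup_set1.
by split; [exact: finite_set1|move=> _ ->].
Qed.

Lemma fin_unionsU (K L : set X) :
  fin_unions B K -> fin_unions B L -> fin_unions B (K `|` L).
Proof.
move=> [F [fF FB] <-] [G [fG GB] <-]; exists (F `|` G); last by rewrite bigcup_setU.
by split; [rewrite finite_setU|move=> ? []; [exact: FB|exact: GB]].
Qed.

Lemma fin_unions_ind (P : set (set X)) : P set0 ->
  (forall K L, P K -> P L -> P (K `|` L)) -> B `<=` P -> fin_unions B `<=` P.
Proof.
move=> P0 PU BP _ [F [/finite_seqP[s ->] sB] <-]; rewrite bigcup_seq.
elim: s sB => [|K s IHs] sB; first by rewrite big_nil.
rewrite big_cons; apply: PU; first by apply/BP/sB; rewrite /= mem_head.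
by apply: IHs => L sL; apply: sB; rewrite /= in_cons sL orbT.
Qed.

End FinUnions.

(* What remains of a compactology once the topologies are forgotten: the closed
   subsets of a member [K] are the members contained in [K], so that compactness
   and separation can be phrased with members only. *)
Record compact_family (X : Type) (M : set (set X)) : Prop := CompactFamily {
  cf_set0 : M set0;
  cf_setU : forall A B, M A -> M B -> M (A `|` B);
  cf_bigcap : forall G : set (set X), G !=set0 -> G `<=` M ->
    M (\bigcap_(K in G) K);
  cf_ultra : forall U, UltraFilter U -> forall K, M K -> U K ->
    exists x, forall F, M F -> U F -> F x;
  cf_sep : forall K x y, M K -> K x -> K y -> x <> y ->
    exists A B, [/\ M A, M B, K `<=` A `|` B, ~ A x & ~ B y];
  cf_cover : forall x, exists2 K, M K & K x
}.

(** * Consequences of the axioms of a compact family *)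

Section CompactFamilyTheory.
Variables (X : Type) (M : set (set X)) (cfM : compact_family M).

Lemma cf_bigcapF (J : Type) (P : set J) (F : J -> set X) : P !=set0 ->
  (forall j, P j -> M (F j)) -> M (\bigcap_(j in P) F j).
Proof.
move=> [j Pj] MF; have -> : \bigcap_(j in P) F j = \bigcap_(L in F @` P) L.
  by rewrite bigcap_image.
apply: (cf_bigcap cfM); first by exists (F j), j.
by move=> _ [k Pk <-]; exact: MF.
Qed.

(** Keeping [K] among the intersected sets allows [P] to be empty and asks only for the traces on
    [K] to be members. *)
Lemma cf_bigcapI (J : Type) (P : set J) (F : J -> set X) (K : set X) : M K ->
  (forall j, P j -> M (K `&` F j)) -> M (K `&` \bigcap_(j in P) F j).
Proof.
move=> MK MF.
have -> : K `&` \bigcap_(j in P) F j =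
    \bigcap_(L in K |` [set K `&` F j | j in P]) L.
  apply/seteqP; split=> [x [Kx Fx] L [->//|[j Pj <-]]|x Hx].
    by split=> //; exact: Fx.
  split=> [|j Pj]; first by apply: Hx; left.
  by have [] : (K `&` F j) x by apply: Hx; right; exists j.
apply: (cf_bigcap cfM); first by exists K; left.
by move=> _ [->//|[j Pj <-]]; exact: MF.
Qed.

Lemma cf_setI (A B : set X) : M A -> M B -> M (A `&` B).
Proof.
move=> MA MB; have -> : A `&` B = \bigcap_(L in [set A; B]) L.
  apply/seteqP; split=> [x [Ax Bx] _ [->|->]//|x H].
  by split; apply: H; [left|right].
by apply: (cf_bigcap cfM) => [|_ [->|->]//]; exists A; left.
Qed.

(** A point is the intersection of the members containing it: separation gives, for any other point
    of [K], a member through [x] that misses it. *)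
Lemma cf_set1 (x : X) : M [set x].
Proof.
have [K MK Kx] := cf_cover cfM x.
have -> : [set x] = \bigcap_(F in [set F | M F /\ F x]) F.
  apply/seteqP; split=> [_ -> F []//|y Hy].
  apply: contrapT => yx; have Ky : K y by apply: Hy.
  have [|A [B [MA MB KAB nAx nBy]]] := @cf_sep _ _ cfM K x y MK Kx Ky.
    by move=> xy; apply: yx; rewrite xy.
  by apply: nBy; apply: Hy; split=> //; case: (KAB x Kx).
by apply: (cf_bigcap cfM) => [|F []//]; exists K.
Qed.

(* The compact set [f @` K] is closed in [L]: for [y] in its closure, the sets
   [f @^-1` N] with [N] a neighbourhood of [y] in [L] generate a filter that
   contains [K], and any cluster point of it is sent to [y]. *)
Lemma cf_image (Z : Type) (N : set (set Z)) (f : Z -> X) (K : set Z) (L : set X) :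
  compact_family N -> N K -> M L -> f @` K `<=` L ->
  (forall F, M F -> N (K `&` f @^-1` F)) -> M (f @` K).
Proof.
move=> cfN NK ML fKL fM.
have -> : f @` K = \bigcap_(F in [set F | M F /\ f @` K `<=` F]) F; last first.
  by apply: (cf_bigcap cfM) => [|F []//]; exists L.
apply/seteqP; split=> [y fy F [_]|y Hy]; first exact.
have Ly : L y by apply: Hy.
(* [D] plays the part of the closed neighbourhoods of [y] in [L]: [B] contains the complement in [L]
   of a closed [A] missing [y]. *)
pose D := [set B | M B /\ exists A, [/\ M A, L `<=` A `|` B & ~ A y]].
pose G := filter_from D (fun B => K `&` f @^-1` B).
have DL : D L.
  by split=> //; exists set0; rewrite set0U; split=> //; exact: cf_set0 cfM.
have PG : ProperFilter G.
  apply: filter_from_proper.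
    apply: filter_from_filter.
      by exists L.
    move=> B B' [MB [A [MA LAB nA]]] [MB' [A' [MA' LAB' nA']]].
    exists (B `&` B'); last by move=> z [Kz [Bz B'z]].
    split; first exact: cf_setI.
    exists (A `|` A'); split=> [|z Lz|[]//]; first exact: cf_setU.
    by move: (LAB z Lz) (LAB' z Lz) => [Az|Bz] [A'z|B'z];
      [left; left|left; left|left; right|right].
  move=> B [MB [A [MA LAB nA]]]; apply: contrapT => H; apply: nA; apply: Hy.
  split=> // _ [z Kz <-]; have [//|Bz] := LAB (f z) (fKL _ (imageP f Kz)).
  by case: H; exists z.
have [U [uU GU]] := ultraFilterLemma PG.
have GK : G K by exists L => // z [].
have [z Hz] := @cf_ultra _ _ cfN U uU K NK (GU _ GK).
have Kz : K z by apply: Hz => //; exact: GU.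
exists z => //; apply: contrapT => fzy.
(* Were $f(z)\neq y$, separation in [L] would give a neighbourhood [B] of [y] that misses $f(z)$,
   against the choice of [z]. *)
have [|A [B [MA MB LAB nAy nBfz]]] :=
  @cf_sep _ _ cfM L y (f z) ML Ly (fKL _ (imageP f Kz)).
  by move=> yE; apply: fzy.
suff [] : (K `&` f @^-1` B) z by [].
apply: Hz; first exact: fM.
by apply: GU; exists B => //; split=> //; exists A.
Qed.

End CompactFamilyTheory.

(** * The members of a compactology form a compact family *)

Section SpaceOf.
Variables (T : Type) (t : topology_on T).

Lemma space_closedP (A : set T) : @closed (space t) A <-> is_open t (~` A).
Proof.
split=> [|oA]; first exact: closed_openC.
by rewrite -(setCK A); apply: (@open_closedC (space t)).
Qed.

End SpaceOf.

Lemma set_val_preimage (X : Type) (K A : set X) :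
  @set_val X K @` (@set_val X K @^-1` A) = K `&` A.
Proof.
apply/seteqP; split=> [_ [x Ax <-]|x [Kx Ax]]; first by split=> //; exact: set_valP.
by exists (SigSub (mem_set Kx)).
Qed.

Lemma set_val_imageK (X : Type) (K : set X) (A : set K) :
  @set_val X K @^-1` (@set_val X K @` A) = A.
Proof.
apply/seteqP; split=> [x [y Ay /val_inj <-]//|x Ax]; by exists x.
Qed.

Lemma set_val_image_sub (X : Type) (K : set X) (A : set K) :
  @set_val X K @` A `<=` K.
Proof. by move=> _ [x _ <-]; exact: set_valP. Qed.

Lemma ultra_limit (S : topologicalType) (U : set_system S) (F : set S) (x : S) :
  UltraFilter U -> U --> x -> closed F -> U F -> F x.
Proof.
move=> uU Ux cF UF; have PU := @ultra_proper _ _ uU; apply: contrapT => nFx.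
have UcF : U (~` F) by apply: Ux; apply: open_nbhs_nbhs; split=> //; exact: closed_openC.
by apply: (filter_not_empty U); rewrite -(setICr F); exact: filterI.
Qed.

(** Lets any compact space serve as the source in [cf_image] and [product_tuple_member]. *)
Lemma compact_hausdorff_family (S : topologicalType) : compact_hausdorff S ->
  compact_family (@closed S).
Proof.
move=> [cS hS]; split.
- exact: closed0.
- exact: closedU.
- by move=> G _ GM; apply: closed_bigI.
- move=> U uU K _ _; move: cS; rewrite compact_ultra => /(_ U uU filterT) [x [_ Ux]].
  by exists x => F; exact: ultra_limit.
- move=> K x y _ _ _ /eqP xy; move: hS; rewrite open_hausdorff.
  move=> /(_ x y xy)[[A B] /= [/set_mem Ax /set_mem By] [oA oB /eqP AB]].
  exists (~` A), (~` B); split=> //; [exact: open_closedC|exact: open_closedC|].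
  by rewrite -setCI AB setC0.
- by move=> x; exists setT => //; exact: closedT.
Qed.

Section FamilyOfCompactology.
Variables (X : Type) (c : compactology X).

(** Closed subsets of the compact set [K] are compact, hence members. Conversely, a member inside
    [K] is compact for its own topology, the restriction of that of [K], so its inclusion is
    continuous and its image compact, hence closed. *)
Lemma member_closedP (K : set X) (A : set K) : members c K ->
  @closed (space (ktop c K)) A <-> members c (set_val @` A).
Proof.
move=> cK; have [KK hK] := members_compact cK.
split=> [clA|cA].
  apply: (members_subcompact cK).
  exact: (@subclosed_compact (space (ktop c K)) _ _ clA KK).
have [LL _] := members_compact cA.
set L := set_val @` A in cA LL.
have LK : L `<=` K by exact: set_val_image_sub.
have -> : A = range (subfun LK).
  apply/seteqP; split=> [x Ax|_ [y _ <-]].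
    have Lx : L (set_val x) by exists x.
    by exists (SigSub (mem_set Lx)) => //; exact/val_inj.
  have [x Ax xy] := set_valP y.
  suff -> : subfun LK y = x by [].
  exact/val_inj.
apply: (@compact_closed (space (ktop c K))) => //.
apply: (@continuous_compact (space (ktop c L)) (space (ktop c K))) => //.
apply: continuous_subspaceT; apply/continuousP => V oV.
change (is_open (ktop c L) (subfun LK @^-1` V)).
by rewrite (ktop_restrict LK cK cA); exists V.
Qed.

Lemma member_subP (K L : set X) : members c K -> L `<=` K ->
  members c L <-> @closed (space (ktop c K)) (@set_val X K @^-1` L).
Proof. by move=> cK /setIidr LK; rewrite member_closedP // set_val_preimage LK. Qed.

Lemma member_openP (K : set X) (U : set K) : members c K ->
  is_open (ktop c K) U <-> members c (set_val @` (~` U)).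
Proof. by move=> cK; rewrite -member_closedP // space_closedP setCK. Qed.

(** Directedness puts two members inside a common member [K], where [member_subP] turns their union
    and intersection into those of closed sets of [K]. *)
Lemma compactology_family : compact_family (members c).
Proof.
have mI A B : members c A -> members c B -> members c (A `&` B).
  move=> cA cB; have [K cK ABK] := members_directed cA cB.
  apply/(member_subP cK); first by move=> x [Ax _]; apply: ABK; left.
  rewrite preimage_setI; apply: closedI; apply/(member_subP cK) => //.
  - by move=> x ?; apply: ABK; left.
  - by move=> x ?; apply: ABK; right.
split.
- have [K cK] := members_nonempty c.
  by apply/(member_subP cK) => //; rewrite preimage_set0; exact: closed0.
- move=> A B cA cB; have [K cK ABK] := members_directed cA cB.
  apply/(member_subP cK) => //; rewrite preimage_setU.
  apply: closedU; apply/(member_subP cK) => //.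
  - by move=> x ?; apply: ABK; left.
  - by move=> x ?; apply: ABK; right.
- move=> G [K GK] GM; have cK := GM _ GK.
  have -> : \bigcap_(F in G) F = \bigcap_(F in G) (K `&` F).
    apply/seteqP; split=> x Hx F GF; last by have [] := Hx _ GF.
    by split; exact: Hx.
  apply/(member_subP cK); first by move=> x /(_ K GK)[].
  rewrite preimage_bigcap; apply: closed_bigI => F GF.
  by apply/(member_subP cK); [exact: subIsetl|exact/mI/GM].
- move=> U uU K cK UK; have [KK _] := members_compact cK.
  have valK : range (@set_val X K) = K.
    by rewrite -[RHS]setIT -set_val_preimage preimage_setT.
  have uV : UltraFilter [set A : set K | U (set_val @` A)].
    by apply: ultra_pull; [exact: val_inj|rewrite valK].
  move: KK; rewrite compact_ultra => /(_ _ uV)[|x [_ Vx]]; first by rewrite /= valK.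
  have PU := @ultra_proper _ _ uU.
  exists (set_val x) => F cF UF.
  have := @ultra_limit (space (ktop c K)) _ (@set_val X K @^-1` F) x uV Vx.
  apply; last by rewrite /= set_val_preimage; exact: filterI.
  by apply/member_closedP => //; rewrite set_val_preimage; exact: mI.
- move=> K x y cK Kx Ky xy.
  have cf := compact_hausdorff_family (members_compact cK).
  have [|A [B [clA clB AB nAx nBy]]] := cf_sep cf (x := SigSub (mem_set Kx))
    (y := SigSub (mem_set Ky)) closedT I I.
    by move=> /(congr1 val).
  exists (set_val @` A), (set_val @` B).
  split; [exact/member_closedP|exact/member_closedP| | |].
  + move=> z Kz; have [Az|Bz] := AB (SigSub (mem_set Kz)) I.
      by left; exists (SigSub (mem_set Kz)).
    by right; exists (SigSub (mem_set Kz)).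
  + move=> [z Az zx]; apply: nAx; suff <- : z = SigSub (mem_set Kx) by [].
    exact/val_inj.
  + move=> [z Az zx]; apply: nBy; suff <- : z = SigSub (mem_set Ky) by [].
    exact/val_inj.
- by move=> x; have : [set: X] x by []; rewrite -(members_cover c) => -[K]; exists K.
Qed.

Lemma associated_closedP (F : set X) :
  @closed (space (associated_topology c)) F <->
  forall K, members c K -> members c (K `&` F).
Proof.
rewrite space_closedP; split=> H K cK; have := H K cK.
  by rewrite member_openP // preimage_setC setCK set_val_preimage.
by rewrite member_openP // preimage_setC setCK set_val_preimage.
Qed.

Lemma member_closed (K : set X) : members c K ->
  @closed (space (associated_topology c)) K.
Proof.
move=> cK; apply/associated_closedP => L cL.
exact: (cf_setI compactology_family).
Qed.

End FamilyOfCompactology.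

(** * The compactology of a compact family *)

Section CompactologyOfFamily.
Variables (X : Type) (M : set (set X)) (cfM : compact_family M).

(* For [K] in [M] it is enough to test [L = K], but this definition gives a
   topology on any [K]. *)
Definition family_open (K : set X) : set (set K) :=
  [set U | forall L, M L -> L `<=` K -> M (L `&` @set_val X K @` (~` U))].

Lemma family_open_setT (K : set X) : family_open [set: K].
Proof. by move=> L ML _; rewrite setCT image_set0 setI0; exact: cf_set0 cfM. Qed.

Lemma family_open_setI (K : set X) : setI_closed (@family_open K).
Proof.
move=> U V oU oV L ML LK; rewrite setCI image_setU setIUr.
by apply: (cf_setU cfM); [exact: oU|exact: oV].
Qed.

Lemma family_open_bigcup (K : set X) (J : Type) (f : J -> set K) :
  (forall j, family_open (f j)) -> family_open (\bigcup_j f j).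
Proof.
move=> of_ L ML LK; rewrite setC_bigcup.
have -> : L `&` set_val @` (\bigcap_j ~` f j) =
    L `&` \bigcap_j (set_val @` (~` f j)).
  apply/seteqP; split=> x [Lx Hx]; split=> //.
    by case: Hx => y fy <- j _; exists y => //; exact: fy.
  exists (SigSub (mem_set (LK x Lx))) => // j _.
  have [y nfy yx] := Hx j I.
  by suff <- : y = SigSub (mem_set (LK x Lx)); [|exact/val_inj].
by apply: (cf_bigcapI cfM) => // j _; exact: of_.
Qed.

Definition family_topology (K : set X) : topology_on K :=
  TopologyOn (@family_open_setT K) (@family_open_setI K) (@family_open_bigcup K).

Lemma family_openP (K : set X) (U : set K) : M K ->
  is_open (family_topology K) U <-> M (set_val @` (~` U)).
Proof.
move=> MK; split=> [/(_ K MK)|MU L ML LK]; last exact: (cf_setI cfM).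
rewrite (setIidr _); last exact: set_val_image_sub.
exact.
Qed.

Lemma family_closedP (K : set X) (A : set K) : M K ->
  @closed (space (family_topology K)) A <-> M (set_val @` A).
Proof. by move=> MK; rewrite space_closedP family_openP // setCK. Qed.

(** The point that [cf_ultra] gives for the ultrafilter pushed to [X] is a limit: if an open [O]
    around it were not in the ultrafilter, the closed complement of [O] would be, and would contain
    the point. *)
Lemma family_compact (K : set X) : M K ->
  compact_hausdorff (space (family_topology K)).
Proof.
move=> MK; split.
  rewrite compact_ultra => U uU _; have PU := @ultra_proper _ _ uU.
  have [|x Hx] := cf_ultra cfM (ultra_push (@set_val X K) uU) MK.
    by rewrite fmapE; apply: filterS filterT => x _; exact: set_valP.
  have Kx : K x.
    by apply: Hx => //; rewrite fmapE; apply: filterS filterT => y _; exact: set_valP.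
  exists (SigSub (mem_set Kx)); split=> // N; rewrite /= nbhsE => -[O [oO Ox] ON].
  apply: filterS ON _; have [//|UnO] := in_ultra_setVsetC O uU.
  suff [y nOy yx] : (set_val @` (~` O)) x.
    by case: nOy; suff -> : y = SigSub (mem_set Kx); [|exact/val_inj].
  apply: Hx; first exact/(family_openP _ MK).
  by rewrite fmapE set_val_imageK.
rewrite open_hausdorff => x y /eqP xy.
have [|A [B [MA MB KAB nAx nBy]]] := cf_sep cfM MK (set_valP x) (set_valP y).
  by move=> /val_inj.
have op (F : set X) : M F -> is_open (family_topology K) (set_val @^-1` (~` F)).
  move=> MF; apply/family_openP => //.
  by rewrite preimage_setC setCK set_val_preimage; exact: (cf_setI cfM).
exists (set_val @^-1` (~` A), set_val @^-1` (~` B)) => /=.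
  by split; exact/mem_set.
split; [exact: op|exact: op|apply/eqP].
rewrite -subset0 => z [nAz nBz]; by case: (KAB _ (set_valP z)).
Qed.

Lemma family_cover : \bigcup_(K in M) K = setT.
Proof. by rewrite -subTset => x _; have [K] := cf_cover cfM x; exists K. Qed.

Lemma family_nonempty : M !=set0.
Proof. by exists set0; exact: cf_set0 cfM. Qed.

Lemma family_directed (K1 K2 : set X) : M K1 -> M K2 ->
  exists2 K3, M K3 & K1 `|` K2 `<=` K3.
Proof. by move=> M1 M2; exists (K1 `|` K2) => //; exact: (cf_setU cfM). Qed.

Lemma family_restrict (K1 K2 : set X) (K21 : K2 `<=` K1) : M K1 -> M K2 ->
  is_open (family_topology K2) =
  [set subfun K21 @^-1` V | V in is_open (family_topology K1)].
Proof.
move=> M1 M2; rewrite predeqE => U; rewrite family_openP //; split=> [MU|].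
  (* The extension of [U] is the complement in [K1] of the closed set $K_2\setminus U$. *)
  exists (set_val @^-1` (~` (set_val @` (~` U)))).
    apply/family_openP => //; rewrite preimage_setC setCK set_val_preimage.
    exact: (cf_setI cfM).
  apply/seteqP; split=> [x /= nUx|x Ux /= [y nUy yx]].
    by apply: contrapT => nU; apply: nUx; exists x.
  by apply: nUy; suff -> : y = x; [|exact/val_inj].
move=> [V /(family_openP _ M1) MV <-].
have -> : set_val @` (~` (subfun K21 @^-1` V)) = K2 `&` (set_val @` (~` V)).
  apply/seteqP; split=> [_ [x nVx <-]|x [K2x [y nVy yx]]].
    by split; [exact: set_valP|exists (subfun K21 x)].
  exists (SigSub (mem_set K2x)) => //=.
  suff <- : y = subfun K21 (SigSub (mem_set K2x)) by [].
  exact/val_inj.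
exact: (cf_setI cfM).
Qed.

Lemma family_subcompact (K : set X) (A : set (space (family_topology K))) :
  M K -> compact A -> M (@set_val X K @` A).
Proof.
move=> MK cA; apply/family_closedP => //.
by apply: compact_closed cA; have [] := family_compact MK.
Qed.

Definition family_compactology : compactology X :=
  Compactology family_nonempty family_compact family_cover family_directed
    family_restrict family_subcompact.

End CompactologyOfFamily.

(** Closed subsets of $f(K)$ are the members inside it, so continuity of [corestr] becomes a
    condition on preimages of members, free of dependent types. *)
Lemma cmp_morphismP (X Y : cmpSet) (f : X -> Y) :
  is_cmp_morphism f <-> forall K, members (cmpl X) K ->
    members (cmpl Y) (f @` K) /\
    forall F, members (cmpl Y) F -> members (cmpl X) (K `&` f @^-1` F).
Proof.
have cfX := compactology_family (cmpl X); have cfY := compactology_family (cmpl Y).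
have preE (K : set X) (F : set Y) :
  set_val @` (@corestr _ _ f K @^-1` (set_val @^-1` F)) =
    K `&` f @^-1` F by rewrite -set_val_preimage.
split=> H K cK; have [cfK fP] := H K cK; split=> //.
  move=> F cF; rewrite -preE; apply/member_closedP => //.
  move/continuous_closedP: fP; apply; apply/member_closedP => //.
  by rewrite set_val_preimage; exact: (cf_setI cfY).
apply/continuous_closedP => A /member_closedP => /(_ cfK) cA.
by apply/member_closedP => //; rewrite -[A]set_val_imageK preE; exact: fP.
Qed.

Lemma cmp_morphism_continuous (X Y : cmpSet) (f : X -> Y) : is_cmp_morphism f ->
  continuous (f : associated_space X -> associated_space Y).
Proof.
move=> /cmp_morphismP fP; apply/continuous_closedP => F /associated_closedP clF.
apply/associated_closedP => K cK; have [cfK fpre] := fP K cK.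
(* Only the part of [F] inside the member $f(K)$ matters, and that part is a member. *)
have -> : K `&` f @^-1` F = K `&` f @^-1` (f @` K `&` F).
  apply/seteqP; split=> x [Kx]; last by case=> _ Fx.
  by move=> Fx; split=> //; split=> //; exists x.
by apply: fpre; exact: clF.
Qed.

(** * Coproducts *)

Lemma existT_injective (J : Type) (T : J -> Type) (j : J) : injective (existT T j).
Proof. by move=> x y; exact: (@existT_inj2 {classic J} T j). Qed.

Section Coproduct.
Variables (J : Type) (C : J -> cmpSet).

Local Notation inj := (existT (fun j => C j : Type)).
Local Notation M := (fin_unions (disjoint_members C)).
Local Notation slice j K := (inj j @^-1` K).

Lemma image_inj j (K : set (C j)) (x : C j) : (inj j @` K) (inj j x) -> K x.
Proof. by move=> [y Ky yx]; rewrite -(existT_injective yx). Qed.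

Lemma image_inj_neq j k (K : set (C j)) (x : C k) : j <> k -> ~ (inj j @` K) (inj k x).
Proof. by move=> jk [y _ /(congr1 (@projT1 _ _))]. Qed.

Let cfC j := compactology_family (cmpl (C j)).

Lemma disjoint_members_inj j (K : set (C j)) : members (cmpl (C j)) K -> M (inj j @` K).
Proof. by move=> cK; apply: sub_fin_unions; exists j => //; exists K. Qed.

(** The second half reduces membership to the slices: below a given member only finitely many slices
    are non-empty, and the induction over finite unions rebuilds [K] from them. *)
Lemma coproduct_memberP (A : set {j & C j}) : M A ->
  (forall j, members (cmpl (C j)) (slice j A)) /\
  (forall K, K `<=` A -> (forall j, members (cmpl (C j)) (slice j K)) -> M K).
Proof.
move: A; apply: fin_unions_ind => /=.
- split=> [j|K]; first by rewrite preimage_set0; exact: cf_set0 (cfC j).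
  by rewrite subset0 => -> _; exact: fin_unions0.
- move=> A B [cA MA] [cB MB]; split=> [j|K KAB cK].
    by rewrite preimage_setU; exact: (cf_setU (cfC j)).
  have -> : K = (K `&` A) `|` (K `&` B) by rewrite -setIUr; apply/esym/setIidl.
  apply: fin_unionsU; [apply: MA|apply: MB]; try exact: subIsetr.
    by move=> j; rewrite preimage_setI; exact: (cf_setI (cfC j)).
  by move=> j; rewrite preimage_setI; exact: (cf_setI (cfC j)).
- move=> _ [j _ [L cL <-]]; split=> [k|K KL cK].
    have [jk|jk] := pselect (j = k).
      subst k; suff -> : slice j (inj j @` L) = L by [].
      by apply/seteqP; split=> x; [exact: image_inj|exists x].
    suff -> : slice k (inj j @` L) = set0 by exact: cf_set0 (cfC k).
    by rewrite -subset0 => x; exact: (image_inj_neq jk).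
  have -> : K = inj j @` slice j K.
    apply/seteqP; split=> [x Kx|_ [x Kx <-]//].
    by have [y Ly yx] := KL x Kx; exists y => //=; rewrite yx.
  exact: disjoint_members_inj.
Qed.

Lemma coproduct_slice (A : set {j & C j}) j : M A -> members (cmpl (C j)) (slice j A).
Proof. by move=> /coproduct_memberP[]. Qed.

Lemma coproduct_family : compact_family M.
Proof.
split.
- exact: fin_unions0.
- by move=> A B; exact: fin_unionsU.
- move=> G [A GA] GM; have [_ MA] := coproduct_memberP (GM _ GA).
  apply: MA => [x Hx|j]; first exact: Hx.
  rewrite preimage_bigcap; apply: (cf_bigcapF (cfC j)); first by exists A.
  by move=> B /GM /coproduct_slice.
- move=> U uU K MK UK; have PU := @ultra_proper _ _ uU.
  (* An ultrafilter containing a finite union contains one of its pieces, so it concentrates on one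
     summand [j]. *)
  have [j [L [cL UL]]] : exists j L, members (cmpl (C j)) L /\ U (inj j @` L).
    move: K MK UK; apply: fin_unions_ind.
    + by move=> /(filter_not_empty U).
    + by move=> A B hA hB /(ultra_setU uU)[/hA|/hB].
    + by move=> _ [j _ [L cL <-]] UL; exists j, L.
  have uV : UltraFilter [set A | U (inj j @` A)].
    apply: ultra_pull => //; first exact: existT_injective.
    by apply: filterS UL => _ [x _ <-]; exists x.
  have [x Hx] := cf_ultra (cfC j) uV cL UL.
  exists (inj j x) => F MF UF; apply: (Hx (slice j F)); first exact: coproduct_slice.
  by apply: filterS (filterI UF UL) => z [Fz [y Ly yz]]; exists y => //=; rewrite yz.
- move=> K [j x] [k y] MK Kx Ky xy; have [_ MsK] := coproduct_memberP MK.
  (* [A L] cuts [K] by [L] in the summand [j] and leaves the other slices of [K] untouched. *)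
  pose A (L : set (C j)) := [set z | K z /\ forall jz : j = projT1 z,
    (inj j @` L) z].
  have MA L : members (cmpl (C j)) L -> M (A L).
    move=> cL; apply: MsK => [z []//|l].
    have [jl|jl] := pselect (j = l); last first.
      have -> : slice l (A L) = slice l K by apply/seteqP; split=> z //= [].
      exact: coproduct_slice.
    subst l; have -> : slice j (A L) = slice j K `&` L.
      apply/seteqP; split=> z /= [Kz].
        by move=> /(_ erefl)/image_inj Lz; split.
      by move=> Lz; split=> // _; exists z.
    by apply: (cf_setI (cfC j)) => //; exact: coproduct_slice.
  have [A0 [B0 [cA0 cB0 KAB nA0 nB0]]] : exists A0 B0,
      [/\ members (cmpl (C j)) A0, members (cmpl (C j)) B0,
          slice j K `<=` A0 `|` B0, ~ A0 x & ~ (inj j @` B0) (inj k y)].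
    have [jk|jk] := pselect (j = k); last first.
      exists set0, (slice j K); rewrite set0U; split=> //; first exact: cf_set0 (cfC j).
        exact: coproduct_slice.
      exact: image_inj_neq.
    subst k; have [|A0 [B0 [cA0 cB0 KAB nA0 nB0]]] :=
      cf_sep (cfC j) (coproduct_slice j MK) Kx Ky; first by move=> xE; rewrite xE in xy.
    by exists A0, B0; split=> // /image_inj.
  exists (A A0), (inj j @` B0); split=> //; first exact: MA.
  + exact: disjoint_members_inj.
  + move=> [l z] Kz; have [jl|jl] := pselect (j = l); last by left; split.
    subst l; have [A0z|B0z] := KAB z Kz; last by right; exists z.
    by left; split=> // _; exists z.
  + by move=> [_ /(_ erefl)/image_inj].
- move=> [j x]; have [K cK Kx] := cf_cover (cfC j) x.
  by exists (inj j @` K); [exact: disjoint_members_inj|exists x].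
Qed.

Definition coproduct_compactology := family_compactology coproduct_family.

Local Notation S := (CmpSet coproduct_compactology).

Lemma coproduct_inj_morphism j : @is_cmp_morphism (C j) S (inj j).
Proof.
apply/cmp_morphismP => K cK; split=> [|F MF]; first exact: disjoint_members_inj.
by apply: (cf_setI (cfC j)) => //; exact: coproduct_slice.
Qed.

Definition coproduct_inj j : cmp_hom (C j) S := 
  exist _ (inj j) (@coproduct_inj_morphism j).

Lemma coproduct_universal (Z : cmpSet) (f : forall j, cmp_hom (C j) Z) :
  exists! g : cmp_hom S Z, forall j, cmp_comp g (coproduct_inj j) = f j.
Proof.
have cfZ := compactology_family (cmpl Z).
pose g (x : S) : Z := sval (f (projT1 x)) (projT2 x).
have gP : @is_cmp_morphism S Z g.
  apply/cmp_morphismP => K MK; split=> [|F cF].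
    move: K MK; apply: fin_unions_ind.
    + by rewrite image_set0; exact: cf_set0 cfZ.
    + by move=> A B cA cB; rewrite image_setU; exact: (cf_setU cfZ).
    + move=> _ [j _ [L cL <-]]; rewrite image_comp.
      have /cmp_morphismP/(_ L cL)[cfL _] := svalP (f j); exact: cfL.
  have [cK MsK] := coproduct_memberP MK; apply: MsK => [x []//|j].
  by have /cmp_morphismP/(_ _ (cK j))[_] := svalP (f j); apply.
exists (exist _ g gP); split=> [j|h hf]; first exact: sig_ext.
apply: sig_ext; apply/funext => -[j x] /=.
by rewrite /g /= -hf.
Qed.

Lemma coproduct_associated_open (U : set {j & C j}) :
  is_open (associated_topology coproduct_compactology) U <->
  @open {j : {classic J} & associated_space (C j)} U.
Proof.
rewrite sigT_openP -[U in is_open _ U]setCK -space_closedP associated_closedP.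
split=> H.
  move=> j; rewrite -closedC preimage_setC; apply/associated_closedP => K cK.
  have -> : K `&` inj j @^-1` (~` U) = slice j (inj j @` K `&` ~` U).
    apply/seteqP; split=> x /= [Kx Ux]; first by split=> //; exists x.
    by move: Kx => /image_inj.
  by apply: coproduct_slice; apply: H; exact: disjoint_members_inj.
move=> K MK; have [cK MsK] := coproduct_memberP MK; apply: MsK => [x []//|j].
have /associated_closedP : @closed (associated_space (C j)) (slice j (~` U)).
  by rewrite -preimage_setC closedC; exact: H.
by rewrite preimage_setI; apply.
Qed.

Lemma coproduct_small (kappa : cardinal) : uncountable kappa -> strong_limit kappa ->
  (forall j, kappa_compactological kappa (C j)) -> kappa_compactological kappa S.
Proof.
move=> unc lim smallC; apply: fin_unions_ind.
- by apply: small_finite => //; exact: finite_set0.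
- by move=> A B; exact: small_setU.
- by move=> _ [j _ [L cL <-]]; apply: small_le (card_image_le _ _) (smallC j L cL).
Qed.

End Coproduct.

(** * Products *)

Section Product.
Variables (J : Type) (C : J -> cmpSet).

Local Notation X := (forall j, C j).
Local Notation fin_boxes := (fin_unions (box_members C)).
Local Notation M := (inter_fin_unions (box_members C)).
Local Notation proj j := (fun x : X => x j).

Let cfC j := compactology_family (cmpl (C j)).

(** The intersected family may be enlarged to all finite unions of boxes containing [K]; the first
    condition says that this family is non-empty. *)
Lemma product_memberP (K : set X) : M K <->
  (exists2 B, fin_boxes B & K `<=` B) /\
  forall x, (forall B, fin_boxes B -> K `<=` B -> B x) -> K x.
Proof.
split=> [[G [[B0 GB0] GB] <-]|[[B0 fB0 KB0] Kx]].
  split=> [|x Hx B GB'].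
    by exists B0; [exact: GB|move=> x; exact].
  by apply: Hx; [exact: GB|move=> y; exact].
exists [set B | fin_boxes B /\ K `<=` B].
  by split=> [|B []//]; exists B0.
apply/seteqP; split=> [x Hx|x Kx' B [_ KB]]; last exact: KB.
by apply: Kx => B fB KB; exact: Hx.
Qed.

Lemma fin_boxes_member : fin_boxes `<=` M.
Proof. by move=> B fB; apply/product_memberP; split=> [|x]; [exists B|exact]. Qed.

Lemma box_member (L : forall j, set (C j)) :
  (forall j, members (cmpl (C j)) (L j)) -> M (box L).
Proof. by move=> cL; apply/fin_boxes_member/sub_fin_unions; exists L. Qed.

(** Two boxes lie in the box of their factorwise unions, so a finite union of boxes fits in a single
    box. *)
Lemma product_member_sub_box (K : set X) : M K ->
  exists2 L : forall j, set (C j), forall j, members (cmpl (C j)) (L j) & K `<=` box L.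
Proof.
move=> /product_memberP[[B fB KB] _].
suff [L cL BL] : exists2 L : forall j, set (C j),
    forall j, members (cmpl (C j)) (L j) & B `<=` box L.
  by exists L => // x /KB/BL.
move: B fB {KB}; apply: fin_unions_ind.
- by exists (fun=> set0) => // j; exact: cf_set0 (cfC j).
- move=> A B [L cL AL] [L' cL' BL']; exists (fun j => L j `|` L' j).
    by move=> j; exact: (cf_setU (cfC j)).
  by move=> x [/AL|/BL'] Hx j; [left|right].
- by move=> _ [L cL <-]; exists L.
Qed.

(** A point outside [A] and [B] is excluded by some [A1] around [A] and some [B1] around [B], hence
    by the finite union of boxes $A_1\cup B_1$. *)
Lemma product_setU (A B : set X) : M A -> M B -> M (A `|` B).
Proof.
move=> /product_memberP[[A0 fA0 AA0] AP] /product_memberP[[B0 fB0 BB0] BP].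
apply/product_memberP; split=> [|x Hx].
  by exists (A0 `|` B0); [exact: fin_unionsU|exact: setUSS].
apply: contrapT => /not_orP[nAx nBx].
have [A1 [fA1 AA1 nA1]] : exists A1, [/\ fin_boxes A1, A `<=` A1 & ~ A1 x].
  apply: contrapT => H; apply: nAx; apply: AP => A1 fA1 AA1.
  by apply: contrapT => nA1; apply: H; exists A1.
have [B1 [fB1 BB1 nB1]] : exists B1, [/\ fin_boxes B1, B `<=` B1 & ~ B1 x].
  apply: contrapT => H; apply: nBx; apply: BP => B1 fB1 BB1.
  by apply: contrapT => nB1; apply: H; exists B1.
by have [] := Hx (A1 `|` B1) (fin_unionsU fA1 fB1) (setUSS AA1 BB1).
Qed.

Lemma product_bigcap (G : set (set X)) : G !=set0 -> G `<=` M ->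
  M (\bigcap_(K in G) K).
Proof.
move=> [K GK] GM; apply/product_memberP; split=> [|x Hx A GA].
  have /product_memberP[[B fB KB] _] := GM K GK.
  by exists B => // x /(_ K GK)/KB.
have /product_memberP[_ AP] := GM A GA.
by apply: AP => B fB AB; apply: Hx => // y /(_ A GA)/AB.
Qed.

Lemma product_member_proj (K : set X) j (F : set (C j)) :
  M K -> members (cmpl (C j)) F -> M (K `&` proj j @^-1` F).
Proof.
move=> MK cF; have [L cL KL] := product_member_sub_box MK.
(* The box [L] with its side [j] cut down by [F]; its trace on [K] is the required set. *)
pose L' := @dfwith {classic J} (fun j => set (C j)) L j (L j `&` F).
have L'P k : @dfwith_spec {classic J} (fun j => set (C j)) L j (L j `&` F) k (L' k).
  exact: dfwithP.
have cL' k : members (cmpl (C k)) (L' k).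
  by case: (L' k) / (L'P k) => //; exact: (cf_setI (cfC j)).
have -> : K `&` proj j @^-1` F = \bigcap_(A in [set K; box L']) A.
  apply/seteqP; split=> [x [Kx Fx] _ [->//|->] k|x Hx].
    case: (L' k) / (L'P k) => [|k' _]; last exact: KL.
    by split=> //; exact: KL.
  have Kx : K x by apply: Hx; left.
  split=> //; have /(_ j) : box L' x by apply: Hx; right.
  by rewrite /L' (@dfwithin {classic J}) => -[].
by apply: product_bigcap => [|_ [->//|->]]; [exists K; left|exact: box_member].
Qed.

Lemma product_family : compact_family M.
Proof.
split.
- exact/fin_boxes_member/fin_unions0.
- exact: product_setU.
- exact: product_bigcap.
- move=> U uU K MK UK; have PU := @ultra_proper _ _ uU.
  have [L cL KL] := product_member_sub_box MK.
  have lim j : exists x, forall F, members (cmpl (C j)) F -> U (proj j @^-1` F) -> F x.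
    have [|x Hx] := cf_ultra (cfC j) (ultra_push (proj j) uU) (cL j).
      by rewrite fmapE; apply: filterS UK => x /KL Lx; exact: Lx.
    by exists x => F cF UF; apply: Hx.
  pose x j := sval (cid (lim j)).
  exists x => F /product_memberP[_ FP] UF; apply: FP => B fB FB.
  have : U B by exact: filterS UF.
  move: B fB {FB}; apply: fin_unions_ind.
  + by move=> /(filter_not_empty U).
  + by move=> A B hA hB /(ultra_setU uU)[/hA|/hB]; [left|right].
  + move=> _ [N cN <-] UN j; apply: (svalP (cid (lim j))); first exact: cN.
    by apply: filterS UN => y; exact.
- move=> K x y MK Kx Ky xy; have [L cL KL] := product_member_sub_box MK.
  (* Distinct tuples differ in some coordinate [j]; a separation there is pulled back along the
     projection. *)
  have [j xyj] : exists j, x j <> y j.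
    apply: contrapT => H; apply: xy; apply: functional_extensionality_dep => j.
    by apply: contrapT => xyj; apply: H; exists j.
  have [A [B [cA cB LAB nA nB]]] := cf_sep (cfC j) (cL j) (KL _ Kx j) (KL _ Ky j) xyj.
  exists (K `&` proj j @^-1` A), (K `&` proj j @^-1` B).
  split; [exact: product_member_proj|exact: product_member_proj| |by case|by case].
  by move=> z Kz; have [Az|Bz] := LAB _ (KL z Kz j); [left|right].
- move=> x; have cov j := cf_cover (cfC j) (x j).
  exists (box (fun j => sval (cid2 (cov j)))).
    by apply: box_member => j; case: cid2.
  by move=> j /=; case: cid2.
Qed.

Lemma product_proj_member j (K : set X) : M K ->
  members (cmpl (C j)) (proj j @` K) /\
  forall F, members (cmpl (C j)) F -> M (K `&` proj j @^-1` F).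
Proof.
move=> MK; split=> [|F]; last exact: product_member_proj.
have [L cL KL] := product_member_sub_box MK.
apply: (cf_image (cfC j) product_family MK (cL j)) => [_ [x /KL Lx <-]//|F].
exact: product_member_proj.
Qed.

(** Preimages commute with intersections and unions, which reduces the claim to one box, an
    intersection of preimages from the factors. The source is any compact family, so that
    compactological sets and compact spaces are both covered. *)
Lemma product_tuple_member (Z : Type) (N : set (set Z)) (f : Z -> X) (K : set Z) :
  compact_family N -> N K ->
  (forall j, members (cmpl (C j)) ((fun z => f z j) @` K)) ->
  (forall j F, members (cmpl (C j)) F -> N (K `&` (fun z => f z j) @^-1` F)) ->
  M (f @` K) /\ forall F, M F -> N (K `&` f @^-1` F).
Proof.
move=> cfN NK fK fpre.
have pre F : M F -> N (K `&` f @^-1` F).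
  move=> [G [G0 GB] <-]; rewrite preimage_bigcap.
  apply: (cf_bigcapI cfN) => // B /GB; move: B; apply: fin_unions_ind.
  - by rewrite preimage_set0 setI0; exact: cf_set0 cfN.
  - by move=> A B NA NB; rewrite preimage_setU setIUr; exact: (cf_setU cfN).
  - move=> _ [L cL <-].
    have -> : f @^-1` box L = \bigcap_j ((fun z => f z j) @^-1` L j).
      by apply/seteqP; split=> z Lz j; [move=> _; exact: Lz|exact: Lz].
    by apply: (cf_bigcapI cfN) => // j _; exact: fpre.
split=> //; apply: (cf_image product_family cfN NK (box_member fK)) => //.
by move=> _ [z Kz <-] j; exists z.
Qed.

Definition product_compactology := family_compactology product_family.

Local Notation P := (CmpSet product_compactology).

Lemma product_proj_morphism j : @is_cmp_morphism P (C j) (proj j).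
Proof. by apply/cmp_morphismP => K; exact: product_proj_member. Qed.

Definition product_proj j : cmp_hom P (C j) := exist _ _ (@product_proj_morphism j).

Lemma product_tuple_morphism (Z : cmpSet) (f : forall j, cmp_hom Z (C j)) (K : set Z) :
  members (cmpl Z) K ->
  M ((fun z j => sval (f j) z) @` K) /\
  forall F, M F -> members (cmpl Z) (K `&` (fun z j => sval (f j) z) @^-1` F).
Proof.
move=> cK; apply: (product_tuple_member (compactology_family (cmpl Z)) cK) => j.
  by have /cmp_morphismP/(_ K cK)[] := svalP (f j).
by have /cmp_morphismP/(_ K cK)[] := svalP (f j).
Qed.

Lemma product_universal (Z : cmpSet) (f : forall j, cmp_hom Z (C j)) :
  exists! g : cmp_hom Z P, forall j, cmp_comp (product_proj j) g = f j.
Proof.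
pose g (z : Z) : X := fun j => sval (f j) z.
have gP : @is_cmp_morphism Z P g by apply/cmp_morphismP; exact: product_tuple_morphism.
exists (exist _ g gP); split=> [j|h hf]; first exact: sig_ext.
apply: sig_ext; apply/funext => z /=; apply: functional_extensionality_dep => j.
by rewrite /g -hf.
Qed.

(** * Products with $\kappa$-small members *)

Section SmallProduct.
Variable kappa : cardinal.
Hypotheses (unc : uncountable kappa) (lim : strong_limit kappa).

Local Notation small A := (card_lt A [set: kappa]).
Local Notation Mk := [set K | M K /\ small K].

(** All operations produce subsets or finite unions of small members. Singletons give the cover,
    because a box around a point may fail to be small. *)
Lemma small_product_family : compact_family Mk.
Proof.
have cfM := product_family.
have subI (A B : set X) : M A -> Mk B -> Mk (B `&` A).
  move=> MA [MB sB]; split; first exact: (cf_setI cfM).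
  by apply: small_le sB; apply: subset_card_le; exact: subIsetl.
split.
- by split; [exact: cf_set0 cfM|apply: (small_finite unc); exact: finite_set0].
- by move=> A B [MA sA] [MB sB]; split; [exact: (cf_setU cfM)|exact: small_setU].
- move=> G [A GA] GM; split.
    by apply: (cf_bigcap cfM) => [|B /GM[]//]; exists A.
  have [_ sA] := GM _ GA; apply: small_le sA; apply: subset_card_le.
  by move=> x; exact.
- move=> U uU K [MK _] UK; have [x Hx] := cf_ultra cfM uU MK UK.
  by exists x => F [MF _]; exact: Hx.
- move=> K x y MkK Kx Ky xy; have [MK _] := MkK.
  have [A [B [MA MB KAB nA nB]]] := cf_sep cfM MK Kx Ky xy.
  exists (K `&` A), (K `&` B); split; [exact: subI|exact: subI| |by case|by case].
  by move=> z Kz; case: (KAB z Kz); [left|right].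
- move=> x; exists [set x] => //; split; first exact: cf_set1 cfM x.
  by apply: (small_finite unc); exact: finite_set1.
Qed.

Definition small_product_compactology := family_compactology small_product_family.

Local Notation Pk := (CmpSet small_product_compactology).

Lemma small_product_proj_morphism j : @is_cmp_morphism Pk (C j) (proj j).
Proof.
apply/cmp_morphismP => K [MK sK]; have [cK pre] := product_proj_member j MK.
split=> // F cF; split; first exact: pre.
by apply: small_le sK; apply: subset_card_le; exact: subIsetl.
Qed.

Definition small_product_proj j : cmp_hom Pk (C j) :=
  exist _ _ (@small_product_proj_morphism j).

Lemma small_product_universal (Z : cmpSet) (f : forall j, cmp_hom Z (C j)) :
  kappa_compactological kappa Z ->
  exists! g : cmp_hom Z Pk, forall j, cmp_comp (small_product_proj j) g = f j.
Proof.
move=> sZ; pose g (z : Z) : X := fun j => sval (f j) z.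
have gP : @is_cmp_morphism Z Pk g.
  apply/cmp_morphismP => K cK; have [MgK pre] := product_tuple_morphism f cK.
  split=> [|F [MF _]]; last exact: pre.
  by split=> //; exact: small_le (card_image_le _ _) (sZ K cK).
exists (exist _ g gP); split=> [j|h hf]; first exact: sig_ext.
apply: sig_ext; apply/funext => z /=; apply: functional_extensionality_dep => j.
by rewrite /g -hf.
Qed.

Lemma small_product_open (K : set X) : Mk K ->
  is_open (ktop small_product_compactology K) = is_open (ktop product_compactology K).
Proof.
move=> MkK; have [MK sK] := MkK; rewrite predeqE => U.
rewrite (member_openP _ (c := small_product_compactology)) //.
rewrite (member_openP _ (c := product_compactology)) //.
split=> [[]//|MU]; split=> //; apply: small_le sK; apply: subset_card_le.
exact: set_val_image_sub.
Qed.

(** Each member lies in a finite union of boxes, so small boxes leave nothing to discard; both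
    topologies are read off from members. *)
Lemma small_boxes_same : (forall B, box_members C B -> small B) ->
  same_compactology small_product_compactology product_compactology.
Proof.
move=> sB; suff ME : Mk = M by split=> // K; exact: small_product_open.
apply/seteqP; split=> [K []//|K MK]; split=> //.
have /product_memberP[[B fB KB] _] := MK.
suff : small B by apply: small_le; exact: subset_card_le.
move: B fB {KB}; apply: fin_unions_ind => //.
- by apply: (small_finite unc); exact: finite_set0.
- by move=> A B; exact: small_setU.
Qed.

(** A small supremum embeds in one segment, which is the uniform bound required by [small_box]. *)
Lemma small_boxes_sup : small [set: J] ->
  (exists L : set kappa,
    is_card_sup (fun j : {j : J & members (cmpl (C j))} => set_val (projT2 j)) L /\
    small L) ->
  forall B, box_members C B -> small B.
Proof.
move=> sJ [L [[supL _] /smallP[x Lx]]] _ [K cK <-].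
apply: (small_box lim sJ (x := x)) => j; apply: card_le_trans Lx.
exact: (supL (existT _ j (SigSub (mem_set (cK j))))).
Qed.

(** Each $K_j$ embeds in the segment below some [x j]. With fewer than $\operatorname{cof}(\kappa)$
    indices the [x j] are bounded by one [y], which again gives a uniform bound. *)
Lemma small_boxes_cof : (forall j, kappa_compactological kappa (C j)) ->
  card_lt_cof [set: J] kappa -> forall B, box_members C B -> small B.
Proof.
move=> sC [S [_ Smin [JS nSJ]]] _ [K cK <-].
have sJ : small [set: J].
  split; first exact: card_le_trans JS (card_leT S).
  by move=> kJ; apply: nSJ; exact: card_le_trans (card_leT S) kJ.
have bnd j : exists x : kappa, K j #<= [set y | ~~ card_order x y].
  by apply/smallP; exact: sC (cK j).
have [x xP] := choice bnd.
(* If no [y] bounded all [x j], their range would be cofinal, and minimality of [S] would give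
   $|S|\le|J|$. *)
have [y yP] : exists y : kappa, forall j, ~~ card_order y (x j).
  apply: contrapT => H; apply: nSJ; apply: card_le_trans (card_image_le x _).
  apply: Smin => y; apply: contrapT => nS; apply: H; exists y => j.
  by apply/negP => yx; apply: nS; exists (x j) => //; exists j.
apply: (small_box lim sJ (x := y)) => j; apply: card_le_trans (xP j) _.
apply: subset_card_le => z /order_lt_trans; apply.
by case: (order_total (x j) y) => // h; have := yP j; rewrite h.
Qed.

End SmallProduct.

End Product.

(** * Compactly generated weak Hausdorff spaces *)

Lemma continuous_compT (R S T : topologicalType) (f : R -> S) (g : S -> T) :
  continuous f -> continuous g -> continuous (g \o f).
Proof. by move=> cf cg x; apply: continuous_comp; [exact: cf|exact: cg]. Qed.

Lemma fst_continuous (S T : topologicalType) : continuous (@fst S T).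
Proof. by move=> [x y]; exact: cvg_fst. Qed.

Lemma snd_continuous (S T : topologicalType) : continuous (@snd S T).
Proof. by move=> [x y]; exact: cvg_snd. Qed.

Section AssociatedSpace.
Variable X : cmpSet.
Let cfX := compactology_family (cmpl X).

Lemma continuous_member_val (K : set X) : members (cmpl X) K ->
  continuous (set_val : space (ktop (cmpl X) K) -> associated_space X).
Proof.
move=> cK; apply/continuous_closedP => F /associated_closedP clF.
by apply/member_closedP => //; rewrite set_val_preimage; exact: clF.
Qed.

(** In a member [K] the range is the image of the closed, hence compact, set $f^{-1}(K)$, so
    [cf_image] applies. *)
Lemma associated_weak_hausdorff : weak_hausdorff (associated_space X).
Proof.
move=> S f cS /continuous_closedP cf; apply/associated_closedP => K cK.
have -> : K `&` range f = f @` (f @^-1` K).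
  apply/seteqP; split=> [y [Ky [x _ xy]]|_ [x Kx <-]].
    by exists x => //=; rewrite xy.
  by split=> //; exists x.
have clK := cf _ (member_closed cK).
apply: (cf_image cfX (compact_hausdorff_family cS) clK cK).
  exact: image_preimage_subset.
by move=> F cF; apply: closedI => //; exact: cf (member_closed cF).
Qed.

Lemma associated_compactly_generated : compactly_generated (associated_space X).
Proof.
move=> F; split=> [clF S f _ /continuous_closedP|clF]; first exact.
apply/associated_closedP => K cK; rewrite -set_val_preimage; apply/member_closedP => //.
exact: clF (members_compact cK) (continuous_member_val cK).
Qed.

Lemma associated_cgwh : is_cgwh (associated_space X).
Proof.
by split; [exact: associated_compactly_generated|exact: associated_weak_hausdorff].
Qed.

End AssociatedSpace.

Lemma compact_hausdorff_prod (S T : topologicalType) : compact_hausdorff S ->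
  compact_hausdorff T -> compact_hausdorff (S * T)%type.
Proof.
move=> [cS hS] [cT hT]; split; first by rewrite -setXTT; exact: compact_setX.
have cfst := @fst_continuous S T; have csnd := @snd_continuous S T.
rewrite open_hausdorff => -[x x'] [y y'] xy.
have [xyE|/eqP xyN] := eqVneq x y.
  have : x' != y' by apply: contra xy => /eqP x'y'; rewrite xyE x'y'.
  move: hT; rewrite open_hausdorff => sep.
  move=> /sep[[A B] /= [/set_mem Ax /set_mem By] [oA oB /eqP AB]].
  exists (snd @^-1` A, snd @^-1` B); first by split; exact/mem_set.
  by split; [exact: open_comp|exact: open_comp|rewrite -preimage_setI AB preimage_set0].
have : x != y by exact/eqP.
move: hS; rewrite open_hausdorff => sep.
move=> /sep[[A B] /= [/set_mem Ax /set_mem By] [oA oB /eqP AB]].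
exists (fst @^-1` A, fst @^-1` B); first by split; exact/mem_set.
by split; [exact: open_comp|exact: open_comp|rewrite -preimage_setI AB preimage_set0].
Qed.

(* The topology of [T * X] generated by the compact sets [T * K] is the product
   topology as far as graphs of continuous maps are concerned: near a point
   outside [E] the complement contains a tube [N * (X - D)], where the
   projection [D] of [E] along the compact set [N] is closed. *)
Lemma closed_graph_preimage (T : topologicalType) (X : cmpSet) (E : set (T * X))
  (f : T -> associated_space X) : compact_hausdorff T -> continuous f ->
  (forall K, members (cmpl X) K ->
    closed [set p : T * space (ktop (cmpl X) K) | E (p.1, set_val p.2)]) ->
  closed [set t | E (t, f t)].
Proof.
move=> cT cf clE; have [KT hT] := cT.
have cfX := compactology_family (cmpl X).
rewrite -[X in closed X]setCK closedC openE => t nE /=.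
have [K cK Kft] := cf_cover cfX (f t).
pose x0 : space (ktop (cmpl X) K) := SigSub (mem_set Kft).
have clE0 : closed [set s | E (s, f t)].
  have cpair : continuous (fun s : T => (s, x0)).
    move=> s A [[U V] [/= Us Vx] UVA]; apply: filterS Us => u Uu; apply: UVA.
    by split=> //=; exact: nbhs_singleton.
  by have /continuous_closedP/(_ _ (clE K cK)) := cpair.
(* Regularity of [T] yields a neighbourhood [N] of [t] whose closure misses the slice of [E] at
   $f(t)$. *)
have [|N Nt Nsub] := @compact_regular _ t _ hT KT filterT (~` [set s | E (s, f t)]).
  by apply: open_nbhs_nbhs; split=> //; exact: closed_openC.
pose D : set X := [set x | exists2 s, closure N s & E (s, x)].
have clD : @closed (associated_space X) D.
  apply/associated_closedP => L cL.
  pose TL : topologicalType := (T * space (ktop (cmpl X) L))%type.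
  have cTL : compact_hausdorff TL by exact: compact_hausdorff_prod (members_compact cL).
  have cval : continuous (set_val \o snd : TL -> associated_space X).
    exact: continuous_compT (@snd_continuous _ _) (continuous_member_val cL).
  pose Z : set TL := fst @^-1` closure N `&` [set p | E (p.1, set_val p.2)].
  have clZ : closed Z.
    apply: closedI; last exact: clE.
    have /continuous_closedP := @fst_continuous T (space (ktop (cmpl X) L)); apply.
    exact: closed_closure.
  (* $L\cap D$ is the projection of the compact set [Z], whose first coordinates lie in the closure
     of [N]. *)
  have -> : L `&` D = (set_val \o snd) @` Z.
    apply/seteqP; split=> [x [Lx [s Ns Esx]]|_ [[s x] [/= Ns Esx] <-]].
      by exists (s, SigSub (mem_set Lx)).
    by split; [exact: set_valP|exists s].
  apply: (cf_image cfX (compact_hausdorff_family cTL) clZ cL).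
    by move=> _ [[s x] _ <-]; exact: set_valP.
  move=> F cF; apply: closedI => //; move/continuous_closedP: cval; apply.
  exact: member_closed.
have nDft : (~` D) (f t) by move=> [s /Nsub nEs Es]; exact: nEs.
have ft : nbhs t (f @^-1` (~` D)).
  by apply: cf; apply: open_nbhs_nbhs; split=> //; exact: closed_openC.
apply: filterS (filterI Nt ft) => s [Ns nDs] Es; apply: nDs; exists s => //.
exact: subset_closure.
Qed.

(** * Finite products in [CGWH] *)

Section FiniteProduct.
Variables (J : Type) (C : J -> cmpSet).

Local Notation X := (forall j, C j).
Local Notation P := (CmpSet (product_compactology C)).

Lemma dfwith_same (g : X) (k : J) :
  @dfwith {classic J} (fun j => C j : Type) g k (g k) = g.
Proof.
by apply: functional_extensionality_dep => j; case: (@dfwithP {classic J}).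
Qed.

(* The factors outside [s] already land in a single member; [s] is emptied one
   factor at a time by replacing that factor with the members of its target. *)
Lemma closed_tuple_preimage (F : set X) (s : seq {classic J}) :
  @closed (associated_space P) F ->
  forall (T : topologicalType) (g : T -> X), compact_hausdorff T ->
  (forall j, continuous ((fun t => g t j) : T -> associated_space (C j))) ->
  (forall j : {classic J}, j \notin s ->
    exists2 L, members (cmpl (C j)) L & forall t, L (g t j)) ->
  closed (g @^-1` F).
Proof.
move=> clF; elim: s => [|k s IHs] T g cT cg gs.
  have bnd j := gs j isT; pose L j := sval (cid2 (bnd j)).
  have cL j : members (cmpl (C j)) (L j) by rewrite /L; case: cid2.
  have gL j t : L j (g t j) by rewrite /L; case: cid2 => /=.
  have cfT := compact_hausdorff_family cT.
  have pre j A : members (cmpl (C j)) A -> closed (setT `&` (fun t => g t j) @^-1` A).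
    move=> cA; rewrite setTI; have /continuous_closedP := cg j; apply.
    exact: member_closed.
  have [|_ ] := product_tuple_member cfT (@closedT T) _ pre.
    move=> j; apply: (cf_image (compactology_family _) cfT closedT (cL j)) => [|A].
      by move=> _ [t _ <-].
    exact: pre.
  (* No factor is left: the range of [g] lies in the box [L], so [F] may be cut down to a member. *)
  move=> /(_ (box L `&` F)); rewrite setTI.
  have -> : g @^-1` (box L `&` F) = g @^-1` F.
    by apply/seteqP; split=> [t []//|t Ft]; split=> // j; exact: gL.
  apply; move/associated_closedP: clF; apply; exact: box_member.
pose upd (y : X) (x : C k) : X := @dfwith {classic J} (fun j => C j : Type) y k x.
have -> : g @^-1` F = [set t | F (upd (g t) (g t k))].
  by apply/seteqP; split=> t; rewrite /upd /= dfwith_same.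
(* The coordinate [k] is made independent of the others: by the graph criterion it may range over a
   member [K], after which [k] leaves the list. *)
apply: (@closed_graph_preimage T (C k) [set p | F (upd (g p.1) p.2)]
  (fun t => g t k)) => // K cK.
apply: (IHs _ (fun p : T * space (ktop (cmpl (C k)) K) => upd (g p.1) (set_val p.2))).
- exact: compact_hausdorff_prod (members_compact cK).
- move=> j; have [kj|kj] := pselect (k = j).
    subst j; have -> : (fun p : T * space (ktop (cmpl (C k)) K) =>
        upd (g p.1) (set_val p.2) k) = set_val \o snd.
      by apply: funext => p; rewrite /upd (@dfwithin {classic J}).
    exact: continuous_compT (@snd_continuous _ _) (continuous_member_val cK).
  have -> : (fun p : T * space (ktop (cmpl (C k)) K) =>
      upd (g p.1) (set_val p.2) j) = (fun t => g t j) \o fst.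
    by apply: funext => p; rewrite /upd (@dfwithout {classic J}) //; exact/eqP.
  exact: continuous_compT (@fst_continuous _ _) (cg j).
- move=> j js; have [kj|kj] := pselect (k = j).
    subst j; exists K => // p; rewrite /upd (@dfwithin {classic J}); exact: set_valP.
  have [|L cL gL] := gs j; first by rewrite in_cons negb_or js andbT eq_sym; exact/eqP.
  by exists L => // p; rewrite /upd (@dfwithout {classic J}) //; exact/eqP.
Qed.

(** Compact generation reduces the claim to maps from compact spaces. The list [s] enumerates all of
    [J], so the condition on factors outside [s] is void. *)
Lemma continuous_tuple (Z : topologicalType) (g : Z -> X) : finite_set [set: J] ->
  compactly_generated Z ->
  (forall j, continuous ((fun z => g z j) : Z -> associated_space (C j))) ->
  continuous (g : Z -> associated_space P).
Proof.
move=> /(@finite_seqP {classic J})[s sE] cgZ cg; apply/continuous_closedP => F clF.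
apply/cgZ => S h cS ch; rewrite -comp_preimage.
apply: (@closed_tuple_preimage F s) => // [j|j].
  exact: continuous_compT ch (cg j).
by have : [set` s] j; [rewrite -sE|move=> /= ->].
Qed.

End FiniteProduct.

Theorem proposition2p17 (kappa : cardinal)
    (kappa_unc : uncountable kappa) (kappa_lim : strong_limit kappa)
    (I : Type) (C : I -> cmpSet)
    (C_small : forall i, kappa_compactological kappa (C i)) :
  (* coproducts in Cmp and in Cmp_kappa *)
  (exists (c : compactology {i : I & C i})
          (inj : forall i, hom Cmp (C i) (CmpSet c)),
    [/\ members c = fin_unions (disjoint_members C),
        (forall i, sval (inj i) = existT (fun j => C j : Type) i),
        is_coproduct Cmp C (CmpSet c) inj,
        (exists c_small : kappa_compactological kappa (CmpSet c),
          is_coproduct (Cmp_kappa kappa)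
            (fun i => exist _ (C i) (C_small i))
            (exist _ (CmpSet c) c_small) inj) &
        (forall U : set {i : I & C i},
          is_open (associated_topology c) U <->
          @open {i : {classic I} & associated_space (C i)} U)])
  /\
  (exists (c : compactology (forall i, C i))
          (proj : forall i, hom Cmp (CmpSet c) (C i)),
    (* products in Cmp *)
    [/\ members c = inter_fin_unions (box_members C),
        (forall i, sval (proj i) = fun x => x i),
        is_product Cmp C (CmpSet c) proj &
        (finite_set [set: I] ->
          exists (Ccgwh : forall i, is_cgwh (associated_space (C i)))
                 (ccgwh : is_cgwh (associated_space (CmpSet c)))
                 (p : forall i, hom Top (associated_space (CmpSet c))
                                               (associated_space (C i))),
            (forall i, sval (p i) = fun x : forall j, C j => x i) /\
            is_product CGWH
              (fun i => exist _ (associated_space (C i)) (Ccgwh i))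
              (exist _ (associated_space (CmpSet c)) ccgwh) p)]
    /\
    (* products in Cmp_kappa *)
    (exists (ck : compactology (forall i, C i))
            (ck_small : kappa_compactological kappa (CmpSet ck))
            (projk : forall i, hom Cmp (CmpSet ck) (C i)),
      [/\ members ck = [set K | members c K /\ card_lt K [set: kappa]],
          (forall K, members ck K -> is_open (ktop ck K) = is_open (ktop c K)),
          (forall i, sval (projk i) = fun x => x i),
          is_product (Cmp_kappa kappa)
            (fun i => exist _ (C i) (C_small i))
            (exist _ (CmpSet ck) ck_small) projk &
          [/\ ((forall B, box_members C B -> card_lt B [set: kappa]) ->
                same_compactology ck c),
              (card_lt [set: I] [set: kappa] ->
                (exists L : set kappa,
                  is_card_sup
                    (fun j : {i : I & members (cmpl (C i))} =>
                       set_val (projT2 j)) L /\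
                  card_lt L [set: kappa]) ->
                same_compactology ck c) &
              (card_lt_cof [set: I] kappa -> same_compactology ck c)]])).
Proof.
split.
  exists (coproduct_compactology C), (coproduct_inj C); split=> //.
  - exact: coproduct_universal.
  (* Morphisms of [Cmp_kappa] are those of [Cmp], so universality carries over once the coproduct is
     known to be $\kappa$-compactological. *)
  - exists (coproduct_small kappa_unc kappa_lim C_small) => -[Z sZ] f.
    exact: (coproduct_universal (f : forall i, cmp_hom (C i) Z)).
  - exact: coproduct_associated_open.
exists (product_compactology C), (product_proj C); split.
  split=> //; first exact: product_universal.
  move=> finI; exists (fun i => associated_cgwh (C i)).
  exists (associated_cgwh (CmpSet (product_compactology C))).
  exists (fun i => exist _ _ (cmp_morphism_continuous (@product_proj_morphism I C i))).
  split=> // -[Z [cgZ wZ]] f.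
  have cg i : continuous (sval (f i)) by exact: svalP (f i).
  pose g (z : Z) : forall i, C i := fun i => sval (f i) z.
  (* Finiteness of [I] and compact generation of [Z] enter here. *)
  have gP : continuous (g : Z -> associated_space (CmpSet (product_compactology C))).
    exact: continuous_tuple.
  exists (exist _ g gP); split=> [i|h hf]; first exact: sig_ext.
  apply: sig_ext; apply/funext => z /=; apply: functional_extensionality_dep => i.
  by rewrite /g -hf.
exists (small_product_compactology C kappa_unc kappa_lim).
have small_ck : kappa_compactological kappa
    (CmpSet (small_product_compactology C kappa_unc kappa_lim)) by move=> K [].
exists small_ck, (small_product_proj C kappa_unc kappa_lim); split=> //.
- exact: small_product_open.
- move=> [Z sZ] f.
  exact: (small_product_universal _ _ (f : forall i, cmp_hom Z (C i)) sZ).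
- split.
  + exact: small_boxes_same.
  + by move=> sI supI; apply: small_boxes_same; exact: small_boxes_sup.
  + by move=> cofI; apply: small_boxes_same; exact: small_boxes_cof.
Qed.
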